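(* Let $k,l\in\mathbb{Z}$ with $kl\neq 0$, let $p$ be an odd prime number with $p\nmid kl$, and let $r$ denote the square-free part of $4k^2l^2-kl$. Suppose that the Legendre symbols satisfy $\left(\dfrac{r}{p}\right)=1$ and $\left(\dfrac{-kl}{p}\right)=1$. Then the group $\pi_1(S^3-J(2k,2l))$ of the double twist knot $J(2k,2l)$ admits a liminal ${\rm SL}_2\mathbb{Z}_p$-representation.
   Context: $\mathbb{Z}_p$ denotes the ring of $p$-adic integers. $J(2k,2l)$ is the double twist knot built from a block of $k$ full twists and a block of $l$ full twists; its group has the presentation $\pi_1(S^3-J(2k,2l))=\langle a,b\mid w^la=bw^l\rangle$ with $w=(ba^{-1})^k(b^{-1}a)^k$ and $a,b$ meridians. An ${\rm SL}_2\mathbb{Z}_p$-representation of a group $\pi$ is a homomorphism $\rho:\pi\to{\rm SL}_2(\mathbb{Z}_p)$. It is liminal if it is reducible and every open neighborhood of it (in ${\rm Hom}(\pi,{\rm SL}_2(\mathbb{Z}_p))$ with the $p$-adic topology, i.e. pointwise convergence) contains an irreducible ${\rm SL}_2\mathbb{Z}_p$-representation. The square-free part of a nonzero integer $c$ is $c/d^2$, where $d$ is the maximal integer with $d^2\mid c$. The Legendre symbol $\left(\frac{c}{p}\right)$ is $0$ if $p\mid c$, is $1$ if $p\nmid c$ and $c$ is a square mod $p$, and is $-1$ otherwise. *)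

(* Defs.v *)
From HB Require Import structures.
From mathcomp Require Import all_boot all_order all_algebra.
From mathcomp Require Import generic_quotient.
From mathcomp Require Import all_classical all_reals all_analysis.

Set Implicit Arguments.
Unset Strict Implicit.
Unset Printing Implicit Defensive.

Import Order.TTheory GRing.Theory Num.Theory.

Local Open Scope quotient_scope.
Local Open Scope classical_set_scope.

Section Presentation.
Variable X : choiceType.

(* The letter (x, false) stands for the generator x, (x, true) for x^-1. *)
Definition word := seq (X * bool).

Definition winv (u : word) : word := rev [seq (t.1, ~~ t.2) | t <- u].

Definition wexp (u : word) (z : int) : word :=
  match z with
  | Posz n => flatten (nseq n u)
  | Negz n => flatten (nseq n.+1 (winv u))
  end.

Variable R : word -> word -> Prop.

Inductive word_eq : word -> word -> Prop :=
| word_eq_refl u : word_eq u u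
| word_eq_sym u v : word_eq u v -> word_eq v u
| word_eq_trans u v w : word_eq u v -> word_eq v w -> word_eq u w
| word_eq_cat u u' v v' :
    word_eq u u' -> word_eq v v' -> word_eq (u ++ v) (u' ++ v')
| word_eq_cancel x e : word_eq [:: (x, e); (x, ~~ e)] [::]
| word_eq_rel u v : R u v -> word_eq u v.

Definition word_eqb (u v : word) : bool := `[< word_eq u v >].

Lemma word_eqb_refl : reflexive word_eqb.
Proof. by move=> u; apply/asboolP; exact: word_eq_refl. Qed.

Lemma word_eqb_sym : symmetric word_eqb.
Proof.
by move=> u v; apply/asboolP/asboolP => h; exact: word_eq_sym.
Qed.

Lemma word_eqb_trans : transitive word_eqb.
Proof.
move=> v u w /asboolP h1 /asboolP h2; apply/asboolP.
exact: word_eq_trans h1 h2.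
Qed.

Canonical word_eqb_equiv :=
  EquivRel word_eqb word_eqb_refl word_eqb_sym word_eqb_trans.

Definition presented := {eq_quot word_eqb}.

HB.instance Definition _ := Choice.on presented.
HB.instance Definition _ : EqQuotient _ word_eqb presented :=
  EqQuotient.on presented.

Definition word_class (u : word) : presented := \pi_presented u.

Lemma word_classP u v : word_class u = word_class v <-> word_eq u v.
Proof.
split=> [/eqP|h].
  by rewrite /word_class eqmodE => /asboolP.
by apply/eqP; rewrite /word_class eqmodE; apply/asboolP.
Qed.

Lemma repr_word_class u : word_eq (repr (word_class u)) u.
Proof. by apply/word_classP; rewrite /word_class reprK. Qed.

Lemma word_eq_winvr u : word_eq (u ++ winv u) [::].
Proof.
elim: u => [|[x e] u IH]; first exact: word_eq_refl.
rewrite /winv /= rev_cons -cats1 -cat_cons.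
apply: (word_eq_trans (v := [:: (x, e)] ++ [:: (x, ~~ e)])); last first.
  exact: word_eq_cancel.
rewrite -[_ :: u](cat1s (x, e) u) -catA; apply: word_eq_cat.
  exact: word_eq_refl.
rewrite catA -[X in word_eq _ X]cat0s.
by apply: word_eq_cat => //; exact: word_eq_refl.
Qed.

Lemma winvK : involutive winv.
Proof.
move=> u; rewrite /winv map_rev revK -map_comp -[RHS]map_id.
by apply: eq_map => -[x e] /=; rewrite negbK.
Qed.

Lemma word_eq_winvl u : word_eq (winv u ++ u) [::].
Proof. by rewrite -{2}(winvK u); exact: word_eq_winvr. Qed.

Lemma word_eq_winv u v : word_eq u v -> word_eq (winv u) (winv v).
Proof.
move=> uv.
apply: (word_eq_trans (v := winv u ++ (v ++ winv v))).
  rewrite -{1}[winv u]cats0; apply: word_eq_cat; first exact: word_eq_refl.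
  exact/word_eq_sym/word_eq_winvr.
rewrite catA -[X in word_eq _ X]cat0s; apply: word_eq_cat; last first.
  exact: word_eq_refl.
apply: word_eq_trans (word_eq_winvl u).
by apply: word_eq_cat; [exact: word_eq_refl|exact: word_eq_sym].
Qed.

Definition presented_mul (x y : presented) : presented :=
  word_class (repr x ++ repr y).
Definition presented_one : presented := word_class [::].
Definition presented_inv (x : presented) : presented :=
  word_class (winv (repr x)).

Lemma presented_mulE u v :
  presented_mul (word_class u) (word_class v) = word_class (u ++ v).
Proof. by apply/word_classP; apply: word_eq_cat; exact: repr_word_class. Qed.

Lemma presented_invE u : presented_inv (word_class u) = word_class (winv u).
Proof. by apply/word_classP; apply: word_eq_winv; exact: repr_word_class. Qed.

Lemma word_class_surj x : word_class (repr x) = x.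
Proof. by rewrite /word_class reprK. Qed.

Lemma presented_mulA : associative presented_mul.
Proof.
move=> x y z.
rewrite -(word_class_surj x) -(word_class_surj y) -(word_class_surj z).
by rewrite !presented_mulE catA.
Qed.

Lemma presented_mul1 : left_id presented_one presented_mul.
Proof. by move=> x; rewrite -(word_class_surj x) presented_mulE cat0s. Qed.

Lemma presented_mulr1 : right_id presented_one presented_mul.
Proof. by move=> x; rewrite -(word_class_surj x) presented_mulE cats0. Qed.

Lemma presented_mulV : left_inverse presented_one presented_inv presented_mul.
Proof.
move=> x; rewrite -(word_class_surj x) presented_invE presented_mulE.
exact/word_classP/word_eq_winvl.
Qed.

Lemma presented_mulrV : right_inverse presented_one presented_inv presented_mul.
Proof.
move=> x; rewrite -(word_class_surj x) presented_invE presented_mulE.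
exact/word_classP/word_eq_winvr.
Qed.

HB.instance Definition _ := isGroup.Build presented
  presented_mulA presented_mul1 presented_mulr1 presented_mulV presented_mulrV.

End Presentation.

(* The presentation of the knot group of J(2k,2l) on two meridians, the letters
   false and true standing for a and b:
   <a, b | w^l a = b w^l>, w = (b a^-1)^k (b^-1 a)^k. *)
Definition gen_a : word bool := [:: (false, false)].
Definition gen_b : word bool := [:: (true, false)].

Definition twist_word (k : int) : word bool :=
  wexp (gen_b ++ winv gen_a) k ++ wexp (winv gen_b ++ gen_a) k.

Inductive twist_relation (k l : int) : word bool -> word bool -> Prop :=
| TwistRelation : twist_relation k l
    (wexp (twist_word k) l ++ gen_a) (gen_b ++ wexp (twist_word k) l).

Definition double_twist_group (k l : int) : groupType :=
  presented (twist_relation k l).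

(* The inverse limit of the rings Z/p^n; the component in Z/p^n is given by its
   representative in [0, p^n). The primality proof is a parameter so that the
   integral domain structure can be inferred. *)
Record padic_int (p : nat) (pp : prime p) := PadicInt {
  residue :> nat -> nat;
  residue_coherent : forall n, residue n = residue n.+1 %% p ^ n
}.

Section PadicInt.
Variables (p : nat) (pp : prime p).
Local Notation Zp := (padic_int pp).

HB.instance Definition _ := gen_eqMixin Zp.
HB.instance Definition _ := gen_choiceMixin Zp.

Lemma padic_intP (x y : Zp) : (forall n, x n = y n) -> x = y.
Proof.
case: x y => [x hx] [y hy] /= /funext exy; subst y.
by rewrite (Prop_irrelevance hx hy).
Qed.

Lemma residueE (x : Zp) m n : n <= m -> x m %% p ^ n = x n.
Proof.
move=> /subnK <-; elim: (m - n) => [|i IH] /=.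
  rewrite add0n (residue_coherent x n) modn_mod //.
rewrite -{}IH addSn (residue_coherent x (i + n)) modn_dvdm //.
by rewrite dvdn_exp2l // leq_addl.
Qed.

Lemma residue_mod (x : Zp) n : x n %% p ^ n = x n.
Proof. exact: residueE. Qed.

Lemma dvd_pS n : p ^ n %| p ^ n.+1.
Proof. by rewrite dvdn_exp2l. Qed.

Lemma padic_const_coherent (c n : nat) : c %% p ^ n = c %% p ^ n.+1 %% p ^ n.
Proof. by rewrite modn_dvdm // dvd_pS. Qed.

Definition padic_const (c : nat) : Zp := PadicInt pp (padic_const_coherent c).

Lemma padic_add_coherent (x y : Zp) n :
  (x n + y n) %% p ^ n = (x n.+1 + y n.+1) %% p ^ n.+1 %% p ^ n.
Proof.
by rewrite modn_dvdm ?dvd_pS // -[in RHS]modnDm !residueE.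
Qed.

Definition padic_add (x y : Zp) : Zp := PadicInt pp (padic_add_coherent x y).

Lemma padic_mul_coherent (x y : Zp) n :
  (x n * y n) %% p ^ n = (x n.+1 * y n.+1) %% p ^ n.+1 %% p ^ n.
Proof.
by rewrite modn_dvdm ?dvd_pS // -[in RHS]modnMm !residueE.
Qed.

Definition padic_mul (x y : Zp) : Zp := PadicInt pp (padic_mul_coherent x y).

Lemma residue_lt (x : Zp) n : x n < p ^ n.
Proof. by rewrite -residue_mod ltn_mod expn_gt0 prime_gt0. Qed.

Lemma padic_opp_coherent (x : Zp) n :
  (p ^ n - x n) %% p ^ n = (p ^ n.+1 - x n.+1) %% p ^ n.+1 %% p ^ n.
Proof.
rewrite modn_dvdm ?dvd_pS //; apply/eqP; rewrite -(eqn_modDr (x n.+1)).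
rewrite subnK; last exact/ltnW/residue_lt.
have -> : (p ^ n.+1 = 0 %[mod p ^ n])%N by rewrite mod0n; apply/eqP; exact: dvd_pS.
rewrite -modnDmr (residueE x (leqnSn n)) subnK; last exact/ltnW/residue_lt.
by rewrite modnn mod0n.
Qed.

Definition padic_opp (x : Zp) : Zp := PadicInt pp (padic_opp_coherent x).

Lemma padic_addA : associative padic_add.
Proof.
by move=> x y z; apply: padic_intP => n /=; rewrite modnDml modnDmr addnA.
Qed.

Lemma padic_addC : commutative padic_add.
Proof. by move=> x y; apply: padic_intP => n /=; rewrite addnC. Qed.

Lemma padic_add0 : left_id (padic_const 0) padic_add.
Proof.
by move=> x; apply: padic_intP => n /=; rewrite mod0n add0n residue_mod.
Qed.

Lemma padic_addN : left_inverse (padic_const 0) padic_opp padic_add.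
Proof.
move=> x; apply: padic_intP => n /=; rewrite modnDml subnK ?modnn ?mod0n //.
exact/ltnW/residue_lt.
Qed.

HB.instance Definition _ :=
  GRing.isZmodule.Build Zp padic_addA padic_addC padic_add0 padic_addN.

Lemma padic_mulA : associative padic_mul.
Proof.
by move=> x y z; apply: padic_intP => n /=; rewrite modnMml modnMmr mulnA.
Qed.

Lemma padic_mulC : commutative padic_mul.
Proof. by move=> x y; apply: padic_intP => n /=; rewrite mulnC. Qed.

Lemma padic_mul1 : left_id (padic_const 1) padic_mul.
Proof.
by move=> x; apply: padic_intP => n /=; rewrite modnMml mul1n residue_mod.
Qed.

Lemma padic_mulD : left_distributive padic_mul +%R.
Proof.
move=> x y z; apply: padic_intP => n /=.
by rewrite modnMml modnDm mulnDl.
Qed.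

Lemma padic_one_neq0 : padic_const 1 != 0%R.
Proof.
apply/eqP => /(congr1 (fun x : Zp => x 1)) /=.
by rewrite expn1 mod0n modn_small // prime_gt1.
Qed.

HB.instance Definition _ := GRing.Zmodule_isComNzRing.Build Zp
  padic_mulA padic_mulC padic_mul1 padic_mulD padic_one_neq0.

Definition padic_unit : {pred Zp} :=
  fun x => `[< exists y : Zp, (y * x)%R = 1%R >].

Definition padic_inv (x : Zp) : Zp :=
  if pselect (exists y : Zp, (y * x)%R = 1%R) is left h then sval (cid h) else x.

Lemma padic_mulVx : {in padic_unit, left_inverse 1%R padic_inv *%R}.
Proof.
move=> x /asboolP hx; rewrite /padic_inv; case: pselect => // h.
by case: (cid h).
Qed.

Lemma padic_unitPl (x y : Zp) : (y * x)%R = 1%R -> padic_unit x.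
Proof. by move=> h; apply/asboolP; exists y. Qed.

Lemma padic_inv_out : {in [predC padic_unit], padic_inv =1 id}.
Proof.
move=> x; rewrite inE /= => hx; rewrite /padic_inv; case: pselect => // h.
by case/negP: hx; apply/asboolP.
Qed.

HB.instance Definition _ := GRing.ComNzRing_hasMulInverse.Build Zp
  padic_mulVx padic_unitPl padic_inv_out.

Lemma padic_neq0 (x : Zp) : x != 0%R -> exists n, x n != 0.
Proof.
move=> /eqP x0; apply: contrapT => h; apply: x0; apply: padic_intP => n /=.
rewrite mod0n; apply/eqP; apply: contrapT => xn; apply: h; exists n.
exact/negP.
Qed.

Lemma padic_integral (x y : Zp) :
  (x * y = 0)%R -> (x == 0%R) || (y == 0%R).
Proof.
move=> xy0; apply/orP; have [x_eq0|/padic_neq0[n xn]] := eqVneq x 0%R; first by left.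
have [y_eq0|/padic_neq0[m ym]] := eqVneq y 0%R; first by right.
exfalso.
have xn' : ~~ (p ^ n %| x (n + m)) by rewrite /dvdn residueE ?leq_addr.
have ym' : ~~ (p ^ m %| y (n + m)) by rewrite /dvdn residueE ?leq_addl.
have x0 : 0 < x (n + m) by case: (x (n + m)) xn' => //; rewrite dvdn0.
have y0 : 0 < y (n + m) by case: (y (n + m)) ym' => //; rewrite dvdn0.
have /eqP : (x * y)%R (n + m) = 0 by rewrite xy0 /= mod0n.
rewrite /= -/(dvdn _ _) pfactor_dvdn ?muln_gt0 ?x0 // lognM //.
move: xn' ym'; rewrite !pfactor_dvdn // -!ltnNge => xn' ym'.
by apply/negP; rewrite -ltnNge -addSn leq_add // ltnW.
Qed.

HB.instance Definition _ := GRing.ComUnitRing_isIntegral.Build Zp padic_integral.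

(* The cosets x + p^n Zp form a basis of neighbourhoods of x. *)
Definition padic_nbhs (x : Zp) : set_system Zp :=
  [set A | exists n, forall y : Zp, y n = x n -> A y].

HB.instance Definition _ := hasNbhs.Build Zp padic_nbhs.

Lemma padic_nbhs_filter (x : Zp) : ProperFilter (nbhs x).
Proof.
split; first by case=> n; apply.
split.
- by exists 0.
- move=> A B [n An] [m Bm]; exists (n + m) => y yx; split.
    by apply: An; rewrite -(residueE y (leq_addr m n)) yx residueE ?leq_addr.
  by apply: Bm; rewrite -(residueE y (leq_addl n m)) yx residueE ?leq_addl.
- by move=> A B AB [n An]; exists n => y /An; exact: AB.
Qed.

Lemma padic_nbhs_singleton (x : Zp) (A : set Zp) : nbhs x A -> A x.
Proof. by case=> n; apply. Qed.

Lemma padic_nbhs_nbhs (x : Zp) (A : set Zp) : nbhs x A -> nbhs x (nbhs^~ A).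
Proof. by case=> n An; exists n => y yx; exists n => z zy; apply: An; rewrite zy. Qed.

HB.instance Definition _ := Nbhs_isNbhsTopological.Build Zp
  padic_nbhs_filter padic_nbhs_singleton padic_nbhs_nbhs.

End PadicInt.

Section SL2.
Variable R : comNzRingType.
Local Open Scope ring_scope.

Definition det_one : pred 'M[R]_2 := fun A => \det A == 1.

Definition SL2 := {A : 'M[R]_2 | det_one A}.

HB.instance Definition _ := Choice.on SL2.

Lemma SL2_det (A : SL2) : \det (val A) = 1.
Proof. exact/eqP/(valP A). Qed.

Lemma SL2_mul_subproof (A B : SL2) : \det (val A *m val B) == 1.
Proof. by rewrite det_mulmx !SL2_det mulr1. Qed.

Lemma SL2_one_subproof : \det (1%:M : 'M[R]_2) == 1.
Proof. by rewrite det1. Qed.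

Lemma SL2_inv_subproof (A : SL2) : \det (\adj (val A)) == 1.
Proof.
have := congr1 determinant (mul_mx_adj (val A)).
by rewrite det_mulmx SL2_det mul1r det1 => ->.
Qed.

Definition SL2_mul (A B : SL2) : SL2 := exist det_one _ (SL2_mul_subproof A B).
Definition SL2_one : SL2 := exist det_one _ SL2_one_subproof.
Definition SL2_inv (A : SL2) : SL2 := exist det_one _ (SL2_inv_subproof A).

Lemma SL2_mulA : associative SL2_mul.
Proof. by move=> A B C; apply/val_inj; rewrite /= mulmxA. Qed.
Lemma SL2_mul1 : left_id SL2_one SL2_mul.
Proof. by move=> A; apply/val_inj; rewrite /= mul1mx. Qed.
Lemma SL2_mulr1 : right_id SL2_one SL2_mul.
Proof. by move=> A; apply/val_inj; rewrite /= mulmx1. Qed.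
Lemma SL2_mulV : left_inverse SL2_one SL2_inv SL2_mul.
Proof. by move=> A; apply/val_inj; rewrite /= mul_adj_mx SL2_det. Qed.
Lemma SL2_mulrV : right_inverse SL2_one SL2_inv SL2_mul.
Proof. by move=> A; apply/val_inj; rewrite /= mul_mx_adj SL2_det. Qed.

HB.instance Definition _ := isGroup.Build SL2
  SL2_mulA SL2_mul1 SL2_mulr1 SL2_mulV SL2_mulrV.

End SL2.

Section Liminal.
Variables (p : nat) (pp : prime p) (G : groupType).
Local Notation Zp := (padic_int pp).
Local Notation Qp := {fraction Zp}.
Local Open Scope ring_scope.

Definition rep := {multiplicative G -> SL2 Zp}.

HB.instance Definition _ := gen_eqMixin rep.
HB.instance Definition _ := gen_choiceMixin rep.

Definition rep_fun (rho : rep) : {ptws G -> 'M[Zp]_2} := fun g => val (rho g).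

HB.instance Definition _ := Topological.copy rep (initial_topology rep_fun).

Definition rep_over (L : fieldType) (f : {rmorphism Qp -> L}) (rho : rep)
    (g : G) : 'M[L]_2 :=
  map_mx (fun x => f (FracField.tofrac x)) (val (rho g)).

Definition reducible_over (L : fieldType) (f : {rmorphism Qp -> L}) (rho : rep) :=
  exists2 v : 'cV[L]_2, v != 0 &
    forall g, exists c : L, rep_over f rho g *m v = c *: v.

Definition reducible (rho : rep) := reducible_over idfun rho.

(* Irreducibility is absolute: it is required over every field extension of Qp.
   Irreducibility over Qp alone would not exclude abelian representations whose
   eigenvalues lie outside Qp, and with it even the trivial representation would
   be a limit of irreducible ones. *)
Definition irreducible (rho : rep) :=
  forall (L : fieldType) (f : {rmorphism Qp -> L}), ~ reducible_over f rho.

Definition liminal (rho : rep) :=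
  reducible rho /\
  forall U : set rep, open U -> U rho -> exists2 sigma, U sigma & irreducible sigma.

End Liminal.

Local Open Scope ring_scope.

Definition max_square_root (c : int) : nat :=
  \max_(d < `|c|%N.+1 | (d ^ 2 %| `|c|)%N) d.

Definition squarefree_part (c : int) : int :=
  (c %/ (max_square_root c)%:Z ^+ 2)%Z.

Definition legendre (c : int) (p : nat) : int :=
  if (p %| c)%Z then 0
  else if `[< exists m : int, (m ^+ 2 = c %[mod p])%Z >] then 1 else -1.

(* Main.v *)
Require Import Defs.
From HB Require Import structures.
From mathcomp Require Import all_boot all_order all_algebra.
From mathcomp Require Import generic_quotient ring zify.
From mathcomp Require Import all_classical all_reals all_analysis.

(* Send the meridians to Riley's matrices a = [m, 1; 0, m^-1] and
   b = [m, 0; -u, m^-1].  With q = (m + m^-1)^2 - u - 4, s = U_k(2 + u),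
   s' = U_(k-1)(2 + u) and t = 2 - s^2 u q = tr w one has
     w^l a - b w^l = (U_l(t) (1 + s (s - s') q) - U_(l-1)(t)) (a - b),
   where the Chebyshev polynomials U are indexed so that U_0 = 0 and U_1 = 1.
   Since U_z(2 + h) = z modulo h, the scalar on the right has the form
   1 + k l q + u K(q).  At u = 0 the representation is upper triangular, and the
   relation holds for q = -1/(kl); then (m - m^-1)^2 = q = -kl / (kl)^2 and
   (m + m^-1)^2 = q + 4 = (4 k^2 l^2 - kl) / (kl)^2 are nonzero squares in Z_p by
   the hypotheses on the Legendre symbols, which yields m.  As kl is a unit,
   Hensel's lemma solves the relation in q for every u divisible by p, and q moves
   by a multiple of u.  For u = p^n (q + 4), with the initial value of q, the
   quantities q + u = (m - m^-1)^2 and q + u + 4 = (m + m^-1)^2 are therefore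
   multiplied by factors that are 1 modulo p^n, and remain squares: this gives
   representations close to the initial one, irreducible because u q <> 0. *)

Set Implicit Arguments.
Unset Strict Implicit.
Unset Printing Implicit Defensive.

Import Order.TTheory GRing.Theory Num.Theory.

Local Open Scope ring_scope.

(** * Arithmetic of p-adic integers *)

Section PadicArithmetic.
Variables (p : nat) (pp : prime p).
Local Notation Zp := (padic_int pp).
Implicit Types (x y z : Zp) (f : {poly Zp}).

Lemma residue0 n : (0 : Zp) n = 0%N.
Proof. exact: mod0n. Qed.

Lemma residueD x x' y y' n : x n = x' n -> y n = y' n -> (x + y) n = (x' + y') n.
Proof. by move=> /= -> ->. Qed.

Lemma residueM x x' y y' n : x n = x' n -> y n = y' n -> (x * y) n = (x' * y') n.
Proof. by move=> /= -> ->. Qed.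

Lemma residueN x x' n : x n = x' n -> (- x) n = (- x') n.
Proof. by move=> /= ->. Qed.

Lemma residueB_eq0 x y n : (x - y) n = 0%N <-> x n = y n.
Proof.
split=> [xy0|xy]; last by rewrite (residueD xy (erefl ((- y) n))) subrr residue0.
rewrite -[x](subrK y); transitivity ((0 + y) n); last by rewrite add0r.
by apply: residueD; rewrite ?residue0.
Qed.

Lemma residue_subr x y n : y n = 0%N -> (x - y) n = x n.
Proof.
move=> y0; apply/residueB_eq0.
by rewrite addrC addKr (@residueN _ 0) ?oppr0 ?residue0.
Qed.

Lemma residue_horner f x y n : x n = y n -> f.[x] n = f.[y] n.
Proof.
move=> xy; elim/poly_ind: f => [|f c IH]; first by rewrite !horner0.
by rewrite !hornerMXaddC; apply: residueD => //; apply: residueM.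
Qed.

Lemma residue_le x m n : (m <= n)%N -> x n = 0%N -> x m = 0%N.
Proof. by move=> mn xn; rewrite -(residueE x mn) xn mod0n. Qed.

Lemma residueM_eq0 x y i j : x i = 0%N -> y j = 0%N -> (x * y) (i + j)%N = 0%N.
Proof.
move=> xi yj; apply/eqP; rewrite -/(dvdn _ _) expnD dvdn_mul // /dvdn.
  by rewrite residueE ?leq_addr // xi.
by rewrite residueE ?leq_addl // yj.
Qed.

Lemma residueMl_eq0 x y n : x n = 0%N -> (x * y) n = 0%N.
Proof. by move=> /= ->; rewrite mul0n mod0n. Qed.

Lemma residue_nat c n : (c%:R : Zp) n = (c %% p ^ n)%N.
Proof.
elim: c => [|c IH]; first by rewrite residue0 mod0n.
by rewrite -addn1 natrD /= IH modnDm.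
Qed.

Lemma residue_int_eq0 (c : int) n : (c%:~R : Zp) n = 0%N <-> ((p ^ n)%N %| c)%Z.
Proof.
have nat_eq0 m : (m%:R : Zp) n = 0%N <-> (p ^ n %| m)%N.
  by rewrite residue_nat; split=> /eqP.
case: c => m; first exact: nat_eq0.
rewrite -[(_ %| _)%Z]/(p ^ n %| m.+1)%N NegzE mulrNz -nat_eq0; split=> [m0|m0].
  by rewrite -[_%:R]opprK -[0%N](residue0 n) -oppr0; apply: residueN; rewrite residue0.
by rewrite -[0%N](residue0 n) -oppr0; apply: residueN; rewrite residue0.
Qed.

Lemma residue_pX n x : (p%:R ^+ n * x) n = 0%N.
Proof. by apply: residueMl_eq0; rewrite -natrX residue_nat modnn. Qed.

Lemma residueD_pX x y m n : (n <= m)%N -> (x + p%:R ^+ m * y) n = x n.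
Proof.
move=> nm; rewrite (@residueD _ x _ 0) ?addr0 // residue0.
exact: residue_le (residue_pX _ _).
Qed.

Lemma pX_neq0 n : p%:R ^+ n != 0 :> Zp.
Proof.
apply/eqP => /(congr1 (fun x : Zp => x n.+1)).
rewrite -natrX residue_nat residue0 modn_small.
  by move/eqP; rewrite -leqn0 leqNgt expn_gt0 prime_gt0.
by rewrite ltn_exp2l // prime_gt1.
Qed.

(** A residue prime to [p] has a Bezout inverse modulo every [p ^ n], and uniqueness of inverses
    makes the chosen ones coherent. *)
Lemma padic_unitP x : reflect (x 1%N <> 0%N) (x \is a GRing.unit).
Proof.
apply: (iffP idP) => [ux x0|x0].
  have /(congr1 (fun y : Zp => y 1%N)) := mulrV ux.
  rewrite (residueMl_eq0 _ x0) -[1]/(1%:R) residue_nat expn1 modn_small //.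
  exact: prime_gt1.
have cop n : coprime (x n) (p ^ n).
  case: n => [|n]; first by rewrite expn0 coprimen1.
  rewrite coprimeXr // coprime_sym prime_coprime //; apply/negP => px.
  apply: x0; rewrite -(residueE x (ltn0Sn n)) expn1; exact/eqP.
have inv_ex n : exists b : nat, ((b * x n) %% p ^ n == 1 %% p ^ n)%N.
  have [xn|xn] := posnP (x n).
    exists 0%N; have := cop n; rewrite xn /coprime gcd0n => /eqP ->.
    by rewrite !modn1.
  case: (egcdnP (p ^ n) xn) => km kn e _; exists km.
  by rewrite e [gcdn _ _](eqP (cop n)) modnMDl.
pose y n := (xchoose (inv_ex n) %% p ^ n)%N.
have yP n : ((y n * x n) %% p ^ n = 1 %% p ^ n)%N.
  by rewrite modnMml; apply/eqP/(xchooseP (inv_ex n)).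
have ycoh n : y n = (y n.+1 %% p ^ n)%N.
  have yS : ((y n.+1 * x n) %% p ^ n = 1 %% p ^ n)%N.
    rewrite -(residueE x (leqnSn n)) modnMmr -(modn_dvdm _ (dvd_pS p n)) yP.
    by rewrite modn_dvdm ?dvd_pS.
  have yy : (y n = y n.+1 %[mod p ^ n])%N.
    have -> : (y n = y n * (y n.+1 * x n) %[mod p ^ n])%N.
      by rewrite -modnMmr yS modnMmr muln1.
    by rewrite mulnCA -modnMmr yP modnMmr muln1.
  by rewrite -yy /y modn_mod.
apply/asboolP; exists (PadicInt pp ycoh); apply: padic_intP => n /=.
exact: yP.
Qed.

Lemma padic_complete (x : nat -> Zp) :
  (forall n, x n.+1 n = x n n) -> exists y : Zp, forall n, y n = x n n.
Proof.
move=> xS; have coh n : x n n = (x n.+1 n.+1 %% p ^ n)%N.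
  by rewrite residueE.
by exists (PadicInt pp coh).
Qed.

Lemma horner_taylor1 f x h : exists c, f.[x + h] = f.[x] + h * f^`().[x] + h ^+ 2 * c.
Proof.
elim/poly_ind: f => [|f a [c IH]]; first by exists 0; rewrite deriv0 !horner0; ring.
exists (c * x + f^`().[x] + h * c).
by rewrite derivD derivC addr0 derivM derivX mulr1 !hornerE IH; ring.
Qed.

(** Newton's iteration with the derivative frozen at the starting point: a single inverse is needed,
    and each step still gains one digit. *)
Lemma hensel f x :
  f.[x] 1%N = 0%N -> f^`().[x] \is a GRing.unit -> exists y, root f y.
Proof.
move=> fx ux.
pose a n := iter n (fun z => z - (f^`().[x])^-1 * f.[z]) x.
have aS n : a n.+1 = a n - (f^`().[x])^-1 * f.[a n] by [].
have aP n : a n 1%N = x 1%N /\ f.[a n] n.+1 = 0%N.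
  elim: n => [|n [an fan]] //.
  have fan1 : f.[a n] 1%N = 0%N by apply: residue_le fan.
  rewrite aS; split.
    by rewrite residue_subr // mulrC residueMl_eq0.
  have [c ->] := horner_taylor1 f (a n) (- ((f^`().[x])^-1 * f.[a n])).
  set g := f^`(); rewrite -/g in ux *.
  (* Taylor's formula leaves [f.[a n]] times a factor divisible by [p]: since [a n] and [x] agree
     modulo [p], so do the derivatives there. *)
  have -> : f.[a n] + - (g.[x]^-1 * f.[a n]) * g.[a n] +
      (- (g.[x]^-1 * f.[a n])) ^+ 2 * c =
      f.[a n] * (g.[x]^-1 * (g.[x] - g.[a n]) + f.[a n] * (g.[x]^-1 ^+ 2 * c)).
    by rewrite mulrDr mulrBr mulVr //; ring.
  rewrite -[n.+2]addn1; apply: residueM_eq0 => //.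
  have residueD_eq0 (b c' : Zp) :
      b 1%N = 0%N -> c' 1%N = 0%N -> (b + c') 1%N = 0%N.
    by move=> b0 c0; rewrite (@residueD _ 0 _ 0) ?addr0 ?residue0.
  apply: residueD_eq0.
    rewrite mulrC residueMl_eq0 //; apply/residueB_eq0/residue_horner.
    by rewrite an.
  by rewrite residueMl_eq0.
have [n|y yP] := padic_complete (x := a).
  rewrite aS residue_subr // mulrC residueMl_eq0 //.
  by have [_] := aP n; apply: residue_le.
exists y; apply/eqP/padic_intP => n; rewrite residue0.
rewrite (residue_horner f (yP n)); have [_] := aP n; exact: residue_le.
Qed.

Lemma padic_unit_int (c : int) : ~~ (p %| c)%Z -> (c%:~R : Zp) \is a GRing.unit.
Proof. by move=> pc; apply/padic_unitP => /residue_int_eq0; rewrite expn1; apply/negP. Qed.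

Lemma padic_int_eq0 (c : int) : c%:~R = 0 :> Zp -> c = 0.
Proof.
move=> c0; have : (c%:~R : Zp) `|c|%N = 0%N by rewrite c0 residue0.
move/residue_int_eq0; rewrite dvdzE /= => pc.
apply/eqP; rewrite -absz_eq0 -leqn0 leqNgt.
by apply/negP => /dvdn_leq /(_ pc); rewrite leqNgt ltn_expl ?prime_gt1.
Qed.

Hypothesis p_odd : odd p.

Lemma padic_unit2 : (2 : Zp) \is a GRing.unit.
Proof.
apply: (padic_unit_int (c := 2)); rewrite -[(_ %| _)%Z]/(p %| 2)%N.
rewrite (dvdn_prime2 pp) //; by apply/eqP => p2; move: p_odd; rewrite p2.
Qed.

(** Hensel's lemma starts at a square root [m] modulo [p]; the derivative [2 * m] is a unit because
    [p] is odd and does not divide [c]. *)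
Lemma padic_sqrt_int (c : int) :
  legendre c p = 1 -> exists x : Zp, x ^+ 2 = c%:~R.
Proof.
rewrite /legendre; case: ifPn => // pc; case: asboolP => // -[m /eqP mc] _.
have um : (m%:~R : Zp) \is a GRing.unit.
  apply: padic_unit_int; apply/negP => pm; move/negP: pc; apply.
  move: mc; rewrite eqz_mod_dvd => mc.
  have pm2 : (p %| m ^+ 2)%Z by rewrite expr2; exact: dvdz_mulr.
  by rewrite -[c](subKr (m ^+ 2)); exact: (rpredB pm2 mc).
have := @hensel ('X^2 - (c%:~R)%:P) (m%:~R).
rewrite derivB derivXn derivC subr0 !hornerE => h.
have [||x] := h.
- rewrite -rmorphXn -rmorphB /=; apply/residue_int_eq0.
  by rewrite expn1 -eqz_mod_dvd.
- by rewrite -mulr2n -mulr_natl unitrM padic_unit2.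
by rewrite /root !hornerE subr_eq0 => /eqP xc; exists x.
Qed.

(** With [P = p ^ (n + 1)], expanding the square and cancelling [P] leaves [P * f ^ 2 + 2 * f = e].
    Modulo [p] this is linear, with solution [e / 2]. *)
Lemma padic_sqrt_near1 n (e : Zp) :
  exists f : Zp, (1 + p%:R ^+ n.+1 * f) ^+ 2 = 1 + p%:R ^+ n.+1 * e.
Proof.
pose P : Zp := p%:R ^+ n.+1.
have P1 x : (P * x) 1%N = 0%N by apply: residue_le (residue_pX _ _).
have [||f] := @hensel (P *: 'X^2 + 2 *: 'X - e%:P) (e / 2).
- rewrite !(hornerD, hornerN, hornerZ, hornerXn, hornerX, hornerC)
    [X in _ + X - _]mulrC divrK ?padic_unit2 // addrK; exact: P1.
- have -> : (P *: 'X^2 + 2 *: 'X - e%:P)^`().[e / 2] = 2 + P * (2 * (e / 2)).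
    rewrite derivB derivD !derivZ derivC derivX derivXn /=.
    by rewrite !(hornerD, hornerN, hornerZ, hornerMn, hornerX, hornerC); ring.
  apply/padic_unitP; rewrite (@residueD _ 2 _ 0) ?addr0 ?residue0 ?P1 //.
  exact/padic_unitP/padic_unit2.
rewrite /root !(hornerD, hornerN, hornerZ, hornerXn, hornerX, hornerC) subr_eq0.
move=> /eqP fe; exists f.
by rewrite -/P -fe; ring.
Qed.

End PadicArithmetic.

(** * Recovery of two mutually inverse elements from their sum and difference *)

Section Halves.
Variables (R : comUnitRingType) (x d : R).
Hypothesis unit2 : (2 : R) \is a GRing.unit.

Lemma half_sumD : (x + d) / 2 + (x - d) / 2 = x.
Proof. by transitivity (x * 2 / 2); [ring|rewrite mulrK]. Qed.

Lemma half_sumM : x ^+ 2 = d ^+ 2 + 4 -> (x + d) / 2 * ((x - d) / 2) = 1.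
Proof.
move=> xd; apply: (mulIr (unitrX 2 unit2)); rewrite mul1r expr2.
transitivity ((x + d) / 2 * 2 * ((x - d) / 2 * 2)); first by ring.
by rewrite !divrK // mulrC -subr_sqr xd; ring.
Qed.

End Halves.

(** * Chebyshev polynomials and powers in SL2 *)

Section Chebyshev.
Variable R : comNzRingType.
Implicit Types (t h : R) (z : int) (n : nat).

(* In classical notation this is U_(n-1)(t/2). *)
Fixpoint chebyshevU_nat t n : R :=
  if n is n1.+1 then
    if n1 is n2.+1 then t * chebyshevU_nat t n1 - chebyshevU_nat t n2 else 1
  else 0.

(** The extension to negative indices is by oddness, which keeps the recursion valid across 0. *)
Definition chebyshevU t z : R :=
  match z with
  | Posz n => chebyshevU_nat t n
  | Negz n => - chebyshevU_nat t n.+1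
  end.

Lemma chebyshevU_natSS t n :
  chebyshevU_nat t n.+2 = t * chebyshevU_nat t n.+1 - chebyshevU_nat t n.
Proof. by []. Qed.

Lemma chebyshevUS t z :
  chebyshevU t (z + 1) = t * chebyshevU t z - chebyshevU t (z - 1).
Proof.
case: z => [[|n]|[|n]].
- by rewrite /=; ring.
- have -> : Posz n.+1 + 1 = Posz n.+2 by lia.
  by have -> : Posz n.+1 - 1 = Posz n by lia.
- by rewrite /=; ring.
- have -> : Negz n.+1 + 1 = Negz n by rewrite !NegzE; lia.
  have -> : Negz n.+1 - 1 = Negz n.+2 by rewrite !NegzE; lia.
  by rewrite /chebyshevU (chebyshevU_natSS t n.+1); ring.
Qed.

Lemma chebyshev_ind (P : int -> Prop) :
  P 0 -> (forall z, P z <-> P (z + 1)) -> forall z, P z.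
Proof.
move=> P0 PS; elim=> [//|n Pn|n Pn].
  by rewrite -addn1 PoszD; exact: (PS n).1.
by apply: (PS _).2; rewrite -addn1 PoszD opprD subrK.
Qed.

(** The quadratic form [a ^ 2 + b ^ 2 - t * a * b] is invariant under the recursion step
    [(a, b) -> (t * a - b, a)]. *)
Lemma chebyshevU_quadric t z :
  chebyshevU t z ^+ 2 + chebyshevU t (z - 1) ^+ 2
    - t * chebyshevU t z * chebyshevU t (z - 1) = 1.
Proof.
elim/chebyshev_ind: z => [|z]; first by rewrite /=; ring.
rewrite addrK chebyshevUS.
set a := chebyshevU t z; set b := chebyshevU t _.
by have -> : (t * a - b) ^+ 2 + a ^+ 2 - t * (t * a - b) * a =
  a ^+ 2 + b ^+ 2 - t * a * b by ring.
Qed.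

(** At [h = 0] the recursion says that second differences vanish, whence the value [z]. As it has
    order two, consecutive indices go through the induction together. *)
Lemma chebyshevU_near2 h z : exists v, chebyshevU (2 + h) z = z%:~R + h * v.
Proof.
suff [v [_ [-> _]]] : exists v v' : R, chebyshevU (2 + h) z = z%:~R + h * v /\
    chebyshevU (2 + h) (z - 1) = (z - 1)%:~R + h * v' by exists v.
elim/chebyshev_ind: z => [|z].
  by exists 0, 0; split; rewrite /= ?mulr0n ?mulr1n; ring.
rewrite addrK chebyshevUS !rmorphB !rmorphD !rmorph1; split=> -[v [v' [e e']]].
  by exists (2 * v - v' + z%:~R + h * v), v; rewrite e e'; split=> //; ring.
exists v', (2 * v' - v + z%:~R + h * v'); split=> //.
by move: e; rewrite e' => /(canRL (subKr _)) ->; ring.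
Qed.

End Chebyshev.

Lemma rmorph_chebyshevU (R S : comNzRingType) (f : {rmorphism R -> S}) t z :
  f (chebyshevU t z) = chebyshevU (f t) z.
Proof.
have natE n : f (chebyshevU_nat t n) = chebyshevU_nat (f t) n.
  elim/ltn_ind: n => -[|[|n]] IH; rewrite ?rmorph0 ?rmorph1 //.
  by rewrite chebyshevU_natSS rmorphB rmorphM !IH.
by case: z => m; rewrite /chebyshevU ?rmorphN natE.
Qed.

(** * Matrices of size two and powers in SL2 *)

Section Mat2.
Variable R : comNzRingType.
Implicit Types a b c d : R.

Definition mat2 a b c d : 'M[R]_2 :=
  \matrix_(i < 2, j < 2)
    if i == 0 then if j == 0 then a else b else if j == 0 then c else d.


Lemma ord2_ind (P : 'I_2 -> Prop) : P 0 -> P 1 -> forall i, P i.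
Proof. by move=> P0 P1 [[|[|//]] i2]; [move: P0|move: P1]; congr P; apply: val_inj. Qed.

Lemma mat2_eta (A : 'M[R]_2) : A = mat2 (A 0 0) (A 0 1) (A 1 0) (A 1 1).
Proof.
by apply/matrixP; elim/ord2_ind; elim/ord2_ind; rewrite mxE.
Qed.

Lemma mat2M a b c d a' b' c' d' :
  mat2 a b c d *m mat2 a' b' c' d' =
  mat2 (a * a' + b * c') (a * b' + b * d') (c * a' + d * c') (c * b' + d * d').
Proof.
by apply/matrixP; elim/ord2_ind; elim/ord2_ind;
  rewrite !mxE big_ord_recl big_ord1 !mxE.
Qed.

Lemma mat2D a b c d a' b' c' d' :
  mat2 a b c d + mat2 a' b' c' d' = mat2 (a + a') (b + b') (c + c') (d + d').
Proof. by apply/matrixP; elim/ord2_ind; elim/ord2_ind; rewrite !mxE. Qed.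

Lemma mat2Z x a b c d : x *: mat2 a b c d = mat2 (x * a) (x * b) (x * c) (x * d).
Proof. by apply/matrixP; elim/ord2_ind; elim/ord2_ind; rewrite !mxE. Qed.

Lemma mat2N a b c d : - mat2 a b c d = mat2 (- a) (- b) (- c) (- d).
Proof. by apply/matrixP; elim/ord2_ind; elim/ord2_ind; rewrite !mxE. Qed.

Lemma mat2_scalar x : x%:M = mat2 x 0 0 x.
Proof. by apply/matrixP; elim/ord2_ind; elim/ord2_ind; rewrite !mxE. Qed.

Lemma mat2_tr a b c d : \tr (mat2 a b c d) = a + d.
Proof. by rewrite /mxtrace big_ord_recl big_ord1 !mxE. Qed.

Lemma mat2_det a b c d : \det (mat2 a b c d) = a * d - b * c.
Proof.
rewrite (expand_det_row _ 0) big_ord_recl big_ord1 /cofactor !det_mx11 !mxE /=.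
by ring. Qed.

Lemma mat2_adj a b c d : \adj (mat2 a b c d) = mat2 d (- b) (- c) a.
Proof.
by apply/matrixP; elim/ord2_ind; elim/ord2_ind;
  rewrite !mxE /cofactor det_mx11 !mxE /=; ring.
Qed.

End Mat2.

Lemma SL2_inv_tr (R : comNzRingType) (M : SL2 R) :
  val (M^-1)%g = (\tr (val M))%:M - val M.
Proof.
rewrite -[val (M^-1)%g]/(\adj (val M)) [val M]mat2_eta.
rewrite mat2_adj mat2_tr mat2_scalar mat2N mat2D.
by congr mat2; ring.
Qed.

Lemma SL2_sqr (R : comNzRingType) (M : SL2 R) :
  val M *m val M = \tr (val M) *: val M - 1%:M.
Proof.
have := mul_mx_adj (val M).
rewrite SL2_det -[\adj _]/(val (M^-1)%g) SL2_inv_tr mulmxBr mul_mx_scalar => <-.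
by rewrite subKr.
Qed.

(** The case split mirrors that of [wexp], so that evaluation of words carries one to the other. *)
Definition zexpg (G : groupType) (x : G) (z : int) : G :=
  match z with Posz n => (x ^+ n)%g | Negz n => (x^-1 ^+ n.+1)%g end.

(** By Cayley-Hamilton the powers of [M] stay in the span of [M] and 1, and their coefficients obey
    the Chebyshev recursion. *)
Lemma SL2_exp (R : comNzRingType) (M : SL2 R) n :
  val (M ^+ n)%g = chebyshevU (\tr (val M)) n *: val M
    - (chebyshevU (\tr (val M)) (n%:Z - 1))%:M.
Proof.
elim: n => [|n IH].
  by rewrite scale0r sub0r -[RHS]raddfN /= opprK.
rewrite monoid.expgSr -[val _]/(val (M ^+ n)%g *m val M) IH mulmxBl -scalemxAl SL2_sqr.
have -> : n.+1%:Z = n%:Z + 1 by lia.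
rewrite mul_scalar_mx addrK chebyshevUS scalerBr scalerBl scalerA.
by rewrite scale_scalar_mx mulr1 [in RHS]mulrC mulrC addrAC.
Qed.

Lemma SL2_zexp (R : comNzRingType) (M : SL2 R) z :
  val (zexpg M z) = chebyshevU (\tr (val M)) z *: val M
    - (chebyshevU (\tr (val M)) (z - 1))%:M.
Proof.
case: z => n; first exact: SL2_exp.
rewrite [zexpg _ _]/(M^-1 ^+ n.+1)%g SL2_exp SL2_inv_tr.
set t := \tr (val M).
(* The inverse has the same trace, so the formula for natural exponents applies to it with the same
   [t]. *)
have -> : \tr (t%:M - val M) = t.
  by rewrite raddfB /= mxtrace_scalar -/t mulr2n addrK.
have -> : Negz n - 1 = Negz n.+1 by rewrite !NegzE; lia.
have -> : Posz n.+1 - 1 = Posz n by lia.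
rewrite /chebyshevU chebyshevU_natSS scalerBr scaleNr.
by rewrite scale_scalar_mx raddfN raddfB /= opprK mulrC [in RHS]addrCA addrA.
Qed.

(** * Riley representations of double twist knot groups *)

Section EvalWord.
Variables (X : choiceType) (G : groupType) (f : X -> G).
Implicit Types u v w : word X.
Local Open Scope group_scope.

Definition eval_letter (a : X * bool) : G := if a.2 then (f a.1)^-1 else f a.1.

Definition eval_word w : G := foldr (fun a g => eval_letter a * g) 1 w.

Lemma eval_word_cat u v : eval_word (u ++ v) = eval_word u * eval_word v.
Proof. by elim: u => [|a u IH]; rewrite ?monoid.mul1g //= IH monoid.mulgA. Qed.

Lemma eval_word_winv u : eval_word (winv u) = (eval_word u)^-1.
Proof.
elim: u => [|[x e] u IH]; first by rewrite monoid.invg1.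
rewrite /winv /= rev_cons -cats1 eval_word_cat [eval_word (rev _)]IH monoid.invgM.
by case: e; rewrite /= /eval_letter /= monoid.mulg1 ?monoid.invgK.
Qed.

Lemma eval_word_wexp u z : eval_word (wexp u z) = zexpg (eval_word u) z.
Proof.
have nseqE v n : eval_word (flatten (nseq n v)) = eval_word v ^+ n.
  elim: n => [//|n IH]; by rewrite [flatten _]/= eval_word_cat IH monoid.expgS.
by case: z => n; rewrite [wexp _ _]/wexp nseqE ?eval_word_winv.
Qed.

Variable R : word X -> word X -> Prop.
Hypothesis R_eval : forall u v, R u v -> eval_word u = eval_word v.

Lemma eval_word_eq u v : word_eq R u v -> eval_word u = eval_word v.
Proof.
elim=> {u v} [//|u v _ ->//|u v w _ -> _ ->//|u u' v v' _ eu _ ev|x e|u v /R_eval//].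
  by rewrite !eval_word_cat eu ev.
by case: e; rewrite /= /eval_letter /= monoid.mulg1 ?monoid.mulgV ?monoid.mulVg.
Qed.

Definition eval_presented (g : presented R) : G := eval_word (repr g).

Lemma eval_presentedM : {morph eval_presented : g h / g * h}.
Proof.
move=> g h; rewrite /eval_presented -eval_word_cat; apply: eval_word_eq.
exact: repr_word_class.
Qed.

End EvalWord.

Lemma SL2_valM (R : comNzRingType) (M N : SL2 R) : val (M * N)%g = val M *m val N.
Proof. by []. Qed.

Lemma SL2_valV (R : comNzRingType) (M : SL2 R) : val (M^-1)%g = \adj (val M).
Proof. by []. Qed.

Section TwistRelation.
Variables (R : comNzRingType) (m mi u : R).
Hypothesis m_mi : m * mi = 1.

Lemma riley_a_det : det_one (mat2 m 1 0 mi).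
Proof. by rewrite /det_one mat2_det m_mi mulr0 subr0. Qed.

Lemma riley_b_det : det_one (mat2 m 0 (- u) mi).
Proof. by rewrite /det_one mat2_det m_mi mul0r subr0. Qed.

Definition riley_a : SL2 R := exist (@det_one R) _ riley_a_det.
Definition riley_b : SL2 R := exist (@det_one R) _ riley_b_det.

Definition riley_gen (x : bool) : SL2 R := if x then riley_b else riley_a.

Lemma riley_twist_relation (k l : int) :
  let q := (m + mi) ^+ 2 - u - 4 in
  let s := chebyshevU (2 + u) k in
  let s' := chebyshevU (2 + u) (k - 1) in
  let t := 2 - s ^+ 2 * u * q in
  chebyshevU t l * (1 + s * (s - s') * q) = chebyshevU t (l - 1) ->
  forall v w, twist_relation k l v w ->
    eval_word riley_gen v = eval_word riley_gen w.
Proof.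
move=> q s s' t tl _ _ []; apply: val_inj.
rewrite !eval_word_cat eval_word_wexp.
have -> : eval_word riley_gen gen_a = riley_a by rewrite /= monoid.mulg1.
have -> : eval_word riley_gen gen_b = riley_b by rewrite /= monoid.mulg1.
set W := eval_word _ (twist_word k).
pose W00 := (s - s') ^+ 2 - s ^+ 2 * u * m ^+ 2.
pose W01 := (s - s') * s * mi - s * m * (s * (u + 1) - s').
pose W11 := (s * (u + 1) - s') ^+ 2 - s ^+ 2 * u * mi ^+ 2.
have WE : val W = mat2 W00 W01 (- u * W01) W11.
  rewrite /W /twist_word eval_word_cat !eval_word_wexp !eval_word_cat !eval_word_winv.
  have -> : eval_word riley_gen gen_a = riley_a by rewrite /= monoid.mulg1.
  have -> : eval_word riley_gen gen_b = riley_b by rewrite /= monoid.mulg1.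
  rewrite SL2_valM !SL2_zexp.
  have -> : val (riley_b * riley_a^-1)%g = mat2 1 (- m) (- u * mi) (u + 1).
    rewrite SL2_valM SL2_valV mat2_adj mat2M.
    by congr mat2; ring: m_mi.
  have -> : val (riley_b^-1 * riley_a)%g = mat2 1 mi (u * m) (u + 1).
    rewrite SL2_valM SL2_valV mat2_adj mat2M.
    by congr mat2; ring: m_mi.
  rewrite !mat2_tr.
  have -> : 1 + (u + 1) = 2 + u by ring.
  rewrite -/s -/s' !mat2_scalar !mat2Z !mat2N !mat2D mat2M.
  by congr mat2; rewrite /W00 /W01 /W11; ring: m_mi.
have ss : s' ^+ 2 = 1 - s ^+ 2 + (2 + u) * s * s'.
  have := chebyshevU_quadric (2 + u) k; rewrite -/s -/s' => e.
  transitivity (s ^+ 2 + s' ^+ 2 - (2 + u) * s * s' - s ^+ 2 + (2 + u) * s * s').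
    by ring.
  by rewrite e.
have Wt : \tr (val W) = t.
  by rewrite WE mat2_tr /W00 /W11 /t /q; ring: m_mi ss.
(* In [w] and its powers the lower left entry is [- u] times the upper right one. Hence
   [w^l a - b w^l] has zero diagonal, and its other entries are 1 and [u] times this combination
   formed for [w^l]. *)
have Wphi : W00 + (mi - m) * W01 = 1 + s * (s - s') * q.
  by rewrite /W00 /W01 /q; ring: m_mi ss.
rewrite !SL2_valM SL2_zexp Wt -tl -Wphi WE mat2_scalar mat2Z mat2N mat2D !mat2M.
by congr mat2; ring: m_mi.
Qed.

End TwistRelation.

(** * Solving the Riley equation near [u = 0] *)

Section RileyEquation.
Variables (p : nat) (pp : prime p) (k l : int).
Hypothesis p_ndvd_kl : ~~ (p %| k * l)%Z.
Local Notation Zp := (padic_int pp).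

(** Since [m] enters only through [q], the equation can be solved in Z_p before [m] is known to
    exist there. *)
Definition riley_equation (u q : Zp) : Prop :=
  let s := chebyshevU (2 + u) k in
  let s' := chebyshevU (2 + u) (k - 1) in
  let t := 2 - s ^+ 2 * u * q in
  chebyshevU t l * (1 + s * (s - s') * q) = chebyshevU t (l - 1).

Lemma riley_equation_solvable (u : Zp) : u 1%N = 0%N ->
  exists q c : Zp, riley_equation u q /\ (k * l)%:~R * q + 1 = u * c.
Proof.
move=> u1; rewrite /riley_equation.
set s := chebyshevU (2 + u) k; set s' := chebyshevU (2 + u) (k - 1).
have [v sE] : exists v, s = k%:~R + u * v := chebyshevU_near2 u k.
have [v' s'E] : exists v', s' = (k - 1)%:~R + u * v' := chebyshevU_near2 u (k - 1).
(* [2 + h] is the trace of [w] with [q] made an indeterminate; the Chebyshev values are taken over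
   [{poly Zp}] to provide a polynomial for Hensel's lemma. *)
pose h : {poly Zp} := - ((s ^+ 2)%:P * u%:P * 'X).
have [V VE] := chebyshevU_near2 h l.
have [V' V'E] := chebyshevU_near2 h (l - 1).
pose g := v + k%:~R * (v - v') + u * v * (v - v').
have ssE : s * (s - s') = k%:~R + u * g.
  by rewrite sE s'E /g rmorphB /= rmorph1; ring.
pose phi : {poly Zp} := 1 + (s * (s - s'))%:P * 'X.
pose K : {poly Zp} := l%:~R * g%:P * 'X - (s ^+ 2)%:P * 'X * (V * phi - V').
pose F : {poly Zp} := chebyshevU (2 + h) l * phi - chebyshevU (2 + h) (l - 1).
(* Modulo [u] one has [h = 0] and [s * (s - s') = k], so [F] becomes
   [l * (1 + k * 'X) - (l - 1)]. *)
have FE : F = 1 + (k * l)%:~R * 'X + u%:P * K.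
  rewrite /F VE V'E /K /phi ssE /h polyCD polyCM.
  have -> : (k%:~R : Zp)%:P = k%:~R by rewrite rmorph_int.
  by rewrite rmorphB /= rmorph1 rmorphM /=; ring.
have FvalE x : F.[x] = 1 + (k * l)%:~R * x + u * K.[x].
  by rewrite FE !(hornerD, hornerM, hornerC, hornerX, hornerMz).
have ukl : ((k * l)%:~R : Zp) \is a GRing.unit by exact: padic_unit_int.
have uM1 x : (u * x) 1%N = 0%N by exact: residueMl_eq0.
have [||q] := @hensel _ _ F (- ((k * l)%:~R)^-1).
- by rewrite FvalE mulrN mulrV // subrr add0r uM1.
- have -> : F = 1 + ((k * l)%:~R)%:P * 'X + u%:P * K by rewrite rmorph_int.
  rewrite !derivD !derivM !derivC derivX !mul0r mulr1 !add0r.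
  rewrite hornerD hornerM !hornerC.
  apply/padic_unitP; rewrite (@residueD _ _ _ (k * l)%:~R _ 0) ?residue0 //.
  by rewrite addr0; exact/padic_unitP.
rewrite /root => /eqP Fq; exists q, (- K.[q]); split.
  have := Fq; rewrite /F hornerD hornerN hornerM => /eqP; rewrite subr_eq0 => /eqP.
  have chebE z : (chebyshevU (2 + h) z).[q] = chebyshevU (2 - s ^+ 2 * u * q) z.
    rewrite -/(horner_eval q _) rmorph_chebyshevU; congr chebyshevU.
    rewrite -[LHS]/((2 + h).[q]) /h.
    by rewrite !(hornerD, hornerN, hornerM, hornerC, hornerX, hornerMn).
  by rewrite !chebE /phi !(hornerD, hornerM, hornerC, hornerX).
by move: Fq => /eqP; rewrite FvalE addr_eq0 addrC mulrN => /eqP.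
Qed.

End RileyEquation.

Section RileyFamily.
Variables (p : nat) (pp : prime p) (k l : int).
Hypotheses (p_odd : odd p) (p_ndvd_kl : ~~ (p %| k * l)%Z).
Local Notation Zp := (padic_int pp).

Lemma riley_equation0 (q : Zp) : (k * l)%:~R * q = -1 -> riley_equation k l 0 q.
Proof.
move=> klq; have val2 z : chebyshevU (2 : Zp) z = z%:~R.
  by have [v] := chebyshevU_near2 (0 : Zp) z; rewrite mul0r !addr0.
rewrite /riley_equation mulr0 mul0r subr0 !addr0 !val2 !rmorphB !rmorph1 /=.
transitivity (l%:~R + (k * l)%:~R * q : Zp); first by rewrite rmorphM /=; ring.
by rewrite klq.
Qed.

Lemma riley_family (x d : Zp) : x != 0 -> (k * l)%:~R * d ^+ 2 = -1 ->
  x ^+ 2 = d ^+ 2 + 4 -> forall n, exists m mi u : Zp,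
  [/\ m * mi = 1, u != 0, (m + mi) ^+ 2 - u - 4 != 0,
      riley_equation k l u ((m + mi) ^+ 2 - u - 4) &
      [/\ m n = ((x + d) / 2) n, mi n = ((x - d) / 2) n & u n = 0%N]].
Proof.
move=> x0 kld xd n.
have u2 := padic_unit2 pp p_odd.
have ukl : ((k * l)%:~R : Zp) \is a GRing.unit by exact: padic_unit_int.
have ud : d \is a GRing.unit.
  rewrite -(@unitrX_pos _ d 2) //; move: (unitr1 Zp); rewrite -(unitrN 1) -kld.
  by rewrite unitrM => /andP[].
(* The exponent [n.+1] makes [u] divisible by [p] even when [n = 0]. The factor [x ^ 2] is there
   because [x] may fail to be a unit, yet [x ^ 2] must divide [q + u + 4]. *)
set P : Zp := p%:R ^+ n.+1; pose u := P * x ^+ 2.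
have u1 : u 1%N = 0%N by apply: residue_le (residue_pX _ _).
have [q [c [qE klq]]] := riley_equation_solvable p_ndvd_kl u1.
pose c1 := c / (k * l)%:~R + 1.
have qu : q + u = d ^+ 2 + u * c1.
  have klc1 : (k * l)%:~R * c1 = c + (k * l)%:~R.
    by rewrite /c1 mulrDr mulr1 mulrC divrK.
  apply: (mulrI ukl); rewrite mulrDr (canRL (addrK _) klq) mulrDr kld.
  rewrite [_ * (u * c1)]mulrCA klc1.
  by ring.
(* By [qu], [q + u + 4 = x ^ 2 * (1 + P * c1)] and [q + u = d ^ 2 * (1 + P * (x ^ 2 * c1 / d ^ 2))];
   square roots of both correction factors are extracted. *)
have [f fE] := padic_sqrt_near1 p_odd n (c1).
have [g gE] := padic_sqrt_near1 p_odd n (x ^+ 2 * c1 / d ^+ 2).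
rewrite -/P in fE gE.
pose x' := x * (1 + P * f); pose d' := d * (1 + P * g).
have x'2 : x' ^+ 2 = q + u + 4.
  by rewrite /x' exprMn fE qu mulrDr mulr1 {1}xd /u; ring.
have d'2 : d' ^+ 2 = q + u.
  rewrite /d' exprMn gE qu mulrDr mulr1 /u mulrCA [d ^+ 2 * _]mulrC divrK ?unitrX //.
  by rewrite mulrA.
exists ((x' + d') / 2), ((x' - d') / 2), u.
rewrite half_sumD //.
have -> : x' ^+ 2 - u - 4 = q by rewrite x'2; ring.
split=> //.
- by apply: half_sumM => //; rewrite x'2 d'2.
- by rewrite /u mulf_neq0 ?pX_neq0 ?expf_neq0.
(* If [q] vanished, 1 would be a multiple of [u], hence 0 modulo [p]. *)
- apply/eqP => q0; move: klq; rewrite q0 mulr0 add0r => e.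
  have /padic_unitP := unitr1 Zp; apply; rewrite e.
  exact: residueMl_eq0.
split.
- rewrite -[RHS](residueD_pX _ (x * f / 2 + d * g / 2) (leqnSn n)) -/P.
  by congr (residue _ n); rewrite /x' /d'; ring.
- rewrite -[RHS](residueD_pX _ (x * f / 2 - d * g / 2) (leqnSn n)) -/P.
  by congr (residue _ n); rewrite /x' /d'; ring.
- by rewrite /u -[P * _]add0r residueD_pX ?residue0.
Qed.

End RileyFamily.

(** * Approximation by irreducible representations *)

Lemma presented_morphism (X : choiceType) (R : word X -> word X -> Prop)
    (G : groupType) (f : X -> G) :
  (forall u v, R u v -> eval_word f u = eval_word f v) ->
  exists rho : {multiplicative presented R -> G},
    forall u, rho (word_class R u) = eval_word f u.
Proof.
move=> fR.
pose M := isMultiplicative.Build _ _ (@eval_presented _ _ f R) (eval_presentedM fR).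
pose rho : {multiplicative presented R -> G} := HB.pack (@eval_presented _ _ f R) M.
exists rho => u; apply: (eval_word_eq fR); exact: repr_word_class.
Qed.

Section Congruence.
Variables (p : nat) (pp : prime p) (n : nat).
Local Notation Zp := (padic_int pp).

Definition SL2_congr (M N : SL2 Zp) := forall i j, (val M i j) n = (val N i j) n.

Lemma SL2_congrM M M' N N' :
  SL2_congr M M' -> SL2_congr N N' -> SL2_congr (M * N)%g (M' * N')%g.
Proof.
move=> eM eN i j; rewrite !SL2_valM !mxE !big_ord_recl !big_ord0.
by do !apply: residueD => //; apply: residueM.
Qed.

Lemma SL2_congrV M N : SL2_congr M N -> SL2_congr (M^-1)%g (N^-1)%g.
Proof.
move=> e i j; rewrite !SL2_valV [val M]mat2_eta [val N]mat2_eta !mat2_adj.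
by elim/ord2_ind: i; elim/ord2_ind: j; rewrite !mxE /=; do ?[exact: e|apply: residueN].
Qed.

(** No precision is lost along a word, so closeness on the two meridians is closeness on the whole
    group. *)
Lemma eval_word_congr (X : choiceType) (f g : X -> SL2 Zp) w :
  (forall x, SL2_congr (f x) (g x)) -> SL2_congr (eval_word f w) (eval_word g w).
Proof.
move=> fg; elim: w => [//|[x e] w IH]; apply: SL2_congrM => //.
by case: e; [apply: SL2_congrV|]; apply: fg.
Qed.

End Congruence.

Lemma eval_word_upper (R : comNzRingType) (X : choiceType) (f : X -> SL2 R) w :
  (forall x, val (f x) 1 0 = 0) -> val (eval_word f w) 1 0 = 0.
Proof.
move=> f0; elim: w => [|[x e] w IH]; first by rewrite mxE.
rewrite SL2_valM mxE big_ord_recl big_ord1.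
have -> : lift ord0 ord0 = 1 :> 'I_2 by apply: val_inj.
rewrite IH mulr0 addr0; suff -> : val (eval_letter f (x, e)) 1 0 = 0 by rewrite mul0r.
case: e; last exact: f0.
rewrite -[eval_letter _ _]/(f x)^-1%g SL2_valV [val _]mat2_eta mat2_adj mxE /=.
by rewrite f0 oppr0.
Qed.

Section Liminality.
Variables (p : nat) (pp : prime p) (G : groupType).
Local Notation Zp := (padic_int pp).
Local Notation Qp := {fraction Zp}.
Local Open Scope classical_set_scope.

Lemma upper_reducible (rho : rep pp G) :
  (forall g, val (rho g) 1 0 = 0) -> reducible rho.
Proof.
move=> rho0; exists (delta_mx 0 0).
  by apply/eqP => /matrixP /(_ 0 0); rewrite !mxE /= => /eqP; rewrite oner_eq0.
move=> g; exists (FracField.tofrac (val (rho g) 0 0)); rewrite -colE.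
apply/matrixP; elim/ord2_ind => j; rewrite ord1 !mxE /= ?mulr1 // rho0.
by rewrite rmorph0 mulr0.
Qed.

(** A common eigenvector [(x, y)] must have both coordinates nonzero; then [b] has eigenvalue [m]
    and [a] has eigenvalue [mi] on it. Comparing the remaining rows gives [u = (mi - m) ^ 2], that
    is [q = 0]. The argument works over any field [L]. *)
Lemma riley_irreducible (sigma : rep pp G) (m mi u : Zp) (m_mi : m * mi = 1) a b :
  sigma a = riley_a m_mi -> sigma b = riley_b u m_mi ->
  u != 0 -> (m + mi) ^+ 2 - u - 4 != 0 -> irreducible sigma.
Proof.
move=> sa sb u0 q0 L f [w w0 fix_w].
pose phi : {rmorphism Zp -> L} := f \o @FracField.tofrac Zp.
have phi_inj x : (phi x == 0) = (x == 0) by rewrite /= fmorph_eq0 tofrac_eq0.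
have [c ea] := fix_w a; have [c' eb] := fix_w b.
have mulE (A : 'M[L]_2) i : (A *m w) i 0 = A i 0 * w 0 0 + A i 1 * w 1 0.
  rewrite mxE big_ord_recl big_ord1.
  by have -> : lift ord0 ord0 = 1 :> 'I_2 by apply: val_inj.
have := congr1 (fun M : 'cV[L]_2 => M 0 0) ea.
have := congr1 (fun M : 'cV[L]_2 => M 1 0) ea.
have := congr1 (fun M : 'cV[L]_2 => M 0 0) eb.
have := congr1 (fun M : 'cV[L]_2 => M 1 0) eb.
rewrite !mulE /rep_over sa sb !mxE /=.
rewrite -![f (FracField.tofrac _)]/(phi _) rmorph0 rmorph1 rmorphN mul1r !mul0r.
rewrite addr0 add0r.
set x := w 0 0; set y := w 1 0 => b1 b0 a1 a0.
have M1 : phi m * phi mi = 1 by rewrite -rmorphM m_mi rmorph1.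
have u0' : phi u != 0 by rewrite phi_inj.
have q0' : (phi m + phi mi) ^+ 2 - phi u - 4 != 0.
  by move: q0; rewrite -phi_inj !rmorphB rmorphXn rmorphD rmorph_nat.
have xn0 : x != 0.
  apply: contra_neq w0 => x0; have y0 : y = 0 by move: a0; rewrite x0 !mulr0 add0r.
  by apply/matrixP; elim/ord2_ind => j; rewrite ord1 mxE.
have c'E : phi m = c' by apply: (mulIf xn0).
have ux : phi u * x = (phi mi - phi m) * y.
  by rewrite mulrBl [in RHS]c'E -b1; ring.
have yn0 : y != 0.
  apply: contraNneq u0' => y0; move: ux => /eqP.
  by rewrite y0 mulr0 mulf_eq0 (negPf xn0) orbF.
have cE : phi mi = c by apply: (mulIf yn0).
have yE : y = (phi mi - phi m) * x by rewrite mulrBl [in phi mi]cE -a0; ring.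
have uE : phi u = (phi mi - phi m) ^+ 2 by apply: (mulIf xn0); rewrite ux yE; ring.
by case/eqP: q0'; rewrite uE; ring: M1.
Qed.

(** Congruences modulo growing powers of [p] give pointwise convergence, so an open set around [rho]
    contains some approximation. *)
Lemma liminal_of_congr (rho : rep pp G) : reducible rho ->
  (forall n, exists2 sigma : rep pp G, irreducible sigma &
     forall g, SL2_congr n (sigma g) (rho g)) ->
  liminal rho.
Proof.
move=> red approx; split=> // U oU Urho.
pose s n := sval (cid2 (approx n)).
have sirr n : irreducible (s n) by rewrite /s; case: cid2.
have scongr n g : SL2_congr n (s n g) (rho g) by rewrite /s; case: cid2.
suff [n Un] : exists n, U (s n) by exists (s n).
case: oU => A oA AU; rewrite -AU in Urho *.
suff cvs : (fun n => rep_fun (s n)) @ \oo --> (rep_fun rho : {ptws G -> 'M[Zp]_2}).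
  have : nbhs (rep_fun rho : {ptws G -> 'M[Zp]_2}) A by apply: open_nbhs_nbhs.
  by move=> /cvs [N _ /(_ N (leqnn _)) ?]; exists N.
apply/cvg_sup => g B; rewrite nbhsE => -[V [[C oC CV] Vrho] VB].
have [P Pnbhs PC] : nbhs (val (rho g)) C.
  by apply: open_nbhs_nbhs; split=> //; move: Vrho; rewrite -CV.
have /choice[N NP] : forall ij : 'I_2 * 'I_2, exists n, forall y : Zp,
  y n = val (rho g) ij.1 ij.2 n -> P ij.1 ij.2 y by move=> ij; exact: Pnbhs.
(* A matrix neighbourhood imposes one precision per entry; the largest of the four serves for
   all. *)
exists (\max_ij N ij)%N => // n /= Nn; apply: VB; rewrite -CV; apply: PC => i j.
apply: (NP (i, j)); have Nij : (N (i, j) <= n)%N.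
  by apply: leq_trans Nn; exact: (leq_bigmax (i, j)).
by rewrite -(residueE _ Nij) -[RHS](residueE _ Nij); congr modn; exact: scongr.
Qed.

End Liminality.

(** * From Legendre symbols to the liminal representation *)

Lemma max_square_root_sqr (c : int) : c != 0 -> ((max_square_root c)%:Z ^+ 2 %| c)%Z.
Proof.
move=> c0; rewrite /max_square_root.
(* The candidate [d = 1] lies in the range, so the maximum is attained at an actual square
   divisor. *)
have c1 : (1 < `|c|%N.+1)%N by rewrite ltnS absz_gt0.
have [|d dc ->] := @eq_bigmax_cond _
  (fun d : 'I_(`|c|%N.+1) => (d ^ 2 %| `|c|)%N) (fun d => d : nat).
  by apply/card_gt0P; exists (Ordinal c1); rewrite unfold_in exp1n dvd1n.
by rewrite dvdzE abszX; exact: dc.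
Qed.

Theorem proposition4p2 (k l : int) (p : nat) (pp : prime p)
    (kl_neq0 : k * l != 0) (p_odd : odd p) (p_ndvd_kl : ~~ (p %| k * l)%Z)
    (legendre_r : legendre (squarefree_part (4 * k ^+ 2 * l ^+ 2 - k * l)) p = 1)
    (legendre_kl : legendre (- (k * l)) p = 1) :
  exists rho : rep pp (double_twist_group k l), liminal rho.
Proof.
set c := 4 * k ^+ 2 * l ^+ 2 - k * l in legendre_r.
have c0 : c != 0.
  have -> : c = k * l * (4 * (k * l) - 1) by rewrite /c; ring.
  by rewrite mulf_neq0 //; lia.
have [x0 x0E] := padic_sqrt_int pp p_odd legendre_r.
have [d0 d0E] := padic_sqrt_int pp p_odd legendre_kl.
have ukl : ((k * l)%:~R : padic_int pp) \is a GRing.unit by exact: padic_unit_int.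
(* The extracted square is restored, turning a root of the square-free part into a root of [c]. *)
pose e : padic_int pp := (max_square_root c)%:R * x0.
have eE : e ^+ 2 = c%:~R.
  rewrite /e exprMn x0E -[in RHS](divzK (max_square_root_sqr c0)) rmorphM rmorphXn.
  by rewrite mulrC.
(* These are [m + m^-1] and [m - m^-1] for the representation at [u = 0]. *)
pose x := e / (k * l)%:~R; pose d := d0 / (k * l)%:~R.
have kld : (k * l)%:~R * d ^+ 2 = -1.
  by rewrite /d exprMn d0E rmorphN mulNr mulrN mulrA -expr2 -exprMn divrr // expr1n.
have xd : x ^+ 2 = d ^+ 2 + 4.
  apply: (mulIr (unitrX 2 ukl)).
  by rewrite mulrDl /x /d -!exprMn !divrK // eE d0E /c; ring.
have xn0 : x != 0.
  apply: contra_neq c0 => x0'; apply: (@padic_int_eq0 p pp).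
  by rewrite -eE -(divrK ukl e) -/x x0' mul0r expr0n.
have u2 := padic_unit2 pp p_odd.
have m_mi := half_sumM u2 xd.
have q0E : ((x + d) / 2 + (x - d) / 2) ^+ 2 - 0 - 4 = d ^+ 2.
  by rewrite half_sumD // xd; ring.
have [|rho rhoE] := @presented_morphism _ (twist_relation k l) _ (riley_gen 0 m_mi).
  by apply: riley_twist_relation; rewrite q0E; exact: riley_equation0.
exists rho; apply: liminal_of_congr.
  apply: upper_reducible => g; rewrite -(word_class_surj g) rhoE.
  by apply: eval_word_upper => -[]; rewrite mxE /= ?oppr0.
move=> n.
have [m [mi [u [mmi un0 qn0 eq_u [m_n mi_n u_n]]]]] :=
  riley_family p_odd p_ndvd_kl xn0 kld xd n.
have [|sigma sigmaE] := @presented_morphism _ (twist_relation k l) _ (riley_gen u mmi).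
  by apply: riley_twist_relation; exact: eq_u.
exists sigma.
  apply: (riley_irreducible (a := word_class _ gen_a) (b := word_class _ gen_b)) un0 qn0.
    by rewrite sigmaE /= monoid.mulg1.
  by rewrite sigmaE /= monoid.mulg1.
move=> g; rewrite -(word_class_surj g) rhoE sigmaE; apply: eval_word_congr.
case; elim/ord2_ind; elim/ord2_ind; rewrite !mxE /= //;
  do ?[exact: m_n|exact: mi_n].
by rewrite u_n mod0n.
Qed.
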